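(* Let $\mathcal X=\mathbb R^d$ with $d\ge2$, and let the output dimension be $D=1$. For $L\in\{2,3\}$, let $\mathcal F_L=\{f\in\mathrm{Lip}(\mathbb R^d;\mathbb R):R_L(f)<+\infty\}$ be the native space of depth-$L$ ReLU networks with weight decay, and let $\mathcal F_{\Theta_2}$ be the set of functions realized by depth-$2$ ReLU networks of arbitrary finite width. Then $\mathcal F_2\subsetneq\mathcal F_3$. Moreover, $$\mathrm{CPWL}(\mathbb R^d;\mathbb R)\cap\mathcal F_2=\mathcal F_{\Theta_2},$$ where $\mathrm{CPWL}(\mathbb R^d;\mathbb R)$ is the set of continuous piecewise linear functions $\mathbb R^d\to\mathbb R$ with finitely many pieces.
   Context: ''Piecewise linear'' means piecewise affine: finitely many (polyhedral) pieces on each of which the function is affine. **Lipschitz space and weak\* topology.** $\mathrm{Lip}(\mathbb R^d;\mathbb R)$ is the space of Lipschitz functions $f:\mathbb R^d\to\mathbb R$ (Euclidean metric), with a base point $\mathrm e\in\mathbb R^d$ and norm $\max\{|f|_{\mathrm{Lip}},|f(\mathrm e)|\}$, $|f|_{\mathrm{Lip}}=\sup_{x\ne y}|f(x)-f(y)|/\|x-y\|_2$. The Arens–Eells space $\mathrm{AE}(\mathbb R^d)$ is the completion of the span of $\{\delta_x-\delta_y\}$ under $\|m\|=\inf\{\sum_i|a_i|\,\|x_i-y_i\|_2: m=\sum_i a_i(\delta_{x_i}-\delta_{y_i})\}$; it is the predual of the Lipschitz functions vanishing at $\mathrm e$, via $\langle\sum_i a_i(\delta_{x_i}-\delta_{y_i}),g\rangle=\sum_i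 a_i(g(x_i)-g(y_i))$. $\mathrm{Lip}(\mathbb R^d)$ is isometrically the dual of $\mathrm{AE}(\mathbb R^d)\oplus_1\mathbb R$, and $w^*$ is the corresponding weak\* topology: the coarsest topology making $f\mapsto\langle m,f-f(\mathrm e)\rangle$ ($m\in\mathrm{AE}(\mathbb R^d)$) and $f\mapsto f(\mathrm e)$ continuous. **Lower semicontinuous regularization.** A function $K$ with values in $[-\infty,+\infty]$ is l.s.c. if all sublevel sets $\{K\le\alpha\}$, $\alpha\in\mathbb R$, are closed. Its l.s.c. regularization is the largest l.s.c. function bounded above by $K$. **Deep ReLU networks.** $\Theta_L$ is the set of tuples $\theta=((W_1,b_1),\dots,(W_L,b_L))$ with $W_\ell\in\mathbb R^{K_{\ell+1}\times K_\ell}$, $b_\ell\in\mathbb R^{K_{\ell+1}}$, $K_1=d$, $K_{L+1}=1$, and arbitrary finite hidden widths $K_2,\dots,K_L\in\mathbb N$. Set $f_\theta=a_L\circ\sigma\circ a_{L-1}\circ\cdots\circ\sigma\circ a_1$, $a_\ell(z)=W_\ell z+b_\ell$, $\sigma=\max\{0,\cdot\}$ entrywise, and $\mathcal F_{\Theta_L}=\{f_\theta:\theta\in\Theta_L\}$. The parameter cost is $C_L(\theta)=\frac1L\sum_{\ell=1}^L\|W_\ell\|_F^2$. Define $R_{\Theta_L}(f)=\inf\{C_L(\theta):\theta\in\Theta_L,\ f_\theta=f\}$ for $f\in\mathrm{Lip}(\mathbb R^d;\mathbb R)$ ($\inf\varnothing=+\infty$). $R_L$ is the $w^*$-l.s.c.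 regularization of $R_{\Theta_L}$ on $\mathrm{Lip}(\mathbb R^d;\mathbb R)$. *)

(* Defs.v *)
From HB Require Import structures.
From mathcomp Require Import all_boot all_order all_algebra.
From mathcomp Require Import all_classical all_reals all_analysis.

Set Implicit Arguments.
Unset Strict Implicit.
Unset Printing Implicit Defensive.

Import Order.TTheory GRing.Theory Num.Theory.
Import numFieldNormedType.Exports.

Local Open Scope classical_set_scope.
Local Open Scope ring_scope.

(* The norm MathComp-Analysis puts on matrices is the sup norm, hence an
   explicit Euclidean norm; both give the same topology. *)
Definition norm2 (R : realType) (d : nat) (x : 'cV[R]_d) : R :=
  Num.sqrt (\sum_i x i ord0 ^+ 2).

Section Lipschitz.
Variables (R : realType) (d : nat).
Notation V := 'cV[R]_d.

Definition lipschitz2 : set (V -> R) :=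
  [set f | exists k : R, forall x y, `|f x - f y| <= k * norm2 (x - y)].

Definition Lip : Type := {f : V -> R | f \in lipschitz2}.

(* A formal combination [:: (a_1, (x_1, y_1)); ...] stands for
   \sum_i a_i (delta_{x_i} - delta_{y_i}). *)
Definition combination := seq (R * (V * V)).

(* Elements of the span are finitely supported functions on R^d, delta_x being
   the indicator of {x}. *)
Definition molecule (s : combination) (p : V) : R :=
  \sum_(t <- s) t.1 * ((p == t.2.1)%:R - (p == t.2.2)%:R).

Definition combination_cost (s : combination) : R :=
  \sum_(t <- s) `|t.1| * norm2 (t.2.1 - t.2.2).

Definition ae_norm (m : V -> R) : R :=
  inf [set combination_cost s | s in [set s | molecule s = m]].

Definition pairing (s : combination) (g : V -> R) : R :=
  \sum_(t <- s) t.1 * (g t.2.1 - g t.2.2).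

Definition ae_cauchy (u : nat -> combination) : Prop :=
  forall eps : R, 0 < eps -> exists N : nat, forall m n : nat,
    (N <= m)%N -> (N <= n)%N ->
    ae_norm (fun p => molecule (u m) p - molecule (u n) p) < eps.

(* The completion, presented by Cauchy sequences.  Sequences at distance 0 are
   not identified: they define the same functional ae_pairing on Lip, so the
   quotient would induce the same topology. *)
Record AE := MkAE { ae_seq :> nat -> combination ; _ : ae_cauchy ae_seq }.

(* The limit exists for Lipschitz g, as `|pairing s g| <= |g|_Lip * ae_norm. *)
Definition ae_pairing (m : AE) (g : V -> R) : R :=
  limn (fun n => pairing (m n) g).

Definition wstar_functional (e : V) (i : option AE) (f : Lip) : R :=
  match i with
  | Some m => ae_pairing m (fun x => val f x - val f e)
  | None => val f e
  end.

(* Lip with its weak* topology: the coarsest topology making all the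
   wstar_functional e i continuous. *)
Definition LipW (e : V) : topologicalType :=
  sup_topology (fun i : option AE =>
    Topological.class (initial_topology (wstar_functional e i))).

End Lipschitz.

Section Semicontinuity.
Local Open Scope ereal_scope.
Variables (R : realType) (T : topologicalType).

Definition lsc (K : T -> \bar R) : Prop :=
  forall a : R, closed [set x | K x <= a%:E].

Lemma lscP (K : T -> \bar R) : lsc K <-> lower_semicontinuous K.
Proof.
rewrite lower_semicontinuousP.
have E a : [set x | K x <= a%:E] = ~` [set x | a%:E < K x].
  by apply/seteqP; split => x /=; rewrite leNgt => /negP.
by split=> H a; have := H a; rewrite E closedC // => /closed_openC; rewrite setCK.
Qed.

Definition lsc_regularization (K : T -> \bar R) (x : T) : \bar R :=
  ereal_sup [set g x | g in [set g | lsc g /\ forall y, g y <= K y]].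

Lemma lsc_regularization_largest (K : T -> \bar R) :
  [/\ lsc (lsc_regularization K), forall x, lsc_regularization K x <= K x &
      forall g, lsc g -> (forall x, g x <= K x) ->
        forall x, g x <= lsc_regularization K x].
Proof.
split=> [a|x|g lg gK x]; last by apply: ereal_sup_ubound; exists g.
- rewrite (_ : mkset _ =
    \bigcap_(g in [set g | lsc g /\ forall y, g y <= K y]) [set x | g x <= a%:E]).
    by apply: closed_bigI => g [lg _]; exact: lg.
  apply/seteqP; split => x /=.
    by move=> xa g gP; apply: le_trans xa; apply: ereal_sup_ubound; exists g.
  by move=> H; apply: ge_ereal_sup => _ [g gP <-]; exact: (H g gP).
- by apply: ge_ereal_sup => _ [g [_ gK] <-]; exact: gK.
Qed.

End Semicontinuity.

(* network R k L is the set of parameters of a network with L affine layers,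
   input dimension k and output dimension 1; hidden widths are existential. *)
Inductive network (R : realType) : nat -> nat -> Type :=
| OutputLayer (k : nat) (W : 'M[R]_(1, k)) (b : 'cV[R]_1) : network R k 1
| HiddenLayer (k k' L : nat) (W : 'M[R]_(k', k)) (b : 'cV[R]_k')
    (theta : network R k' L) : network R k L.+1.

Definition relu (R : realType) (k : nat) (z : 'cV[R]_k) : 'cV[R]_k :=
  map_mx (Num.max 0) z.

Fixpoint realization (R : realType) (k L : nat) (theta : network R k L) :
    'cV[R]_k -> R :=
  match theta with
  | OutputLayer _ W b => fun z => (W *m z + b) ord0 ord0
  | HiddenLayer _ _ _ W b theta' => fun z => realization theta' (relu (W *m z + b))
  end.

Definition frobenius2 (R : realType) (m n : nat) (W : 'M[R]_(m, n)) : R :=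
  \sum_i \sum_j W i j ^+ 2.

Fixpoint weight_sum (R : realType) (k L : nat) (theta : network R k L) : R :=
  match theta with
  | OutputLayer _ W _ => frobenius2 W
  | HiddenLayer _ _ _ W _ theta' => frobenius2 W + weight_sum theta'
  end.

Definition param_cost (R : realType) (k L : nat) (theta : network R k L) : R :=
  L%:R^-1 * weight_sum theta.

Section NativeSpaces.
Variables (R : realType) (d : nat).
Notation V := 'cV[R]_d.

Definition realizable (L : nat) : set (V -> R) :=
  [set f | exists theta : network R d L, realization theta = f].

Definition R_Theta (L : nat) (f : Lip R d) : \bar R :=
  ereal_inf [set (param_cost theta)%:E |
    theta in [set theta : network R d L | realization theta = val f]].

Definition R_native (e : V) (L : nat) (f : LipW e) : \bar R :=
  @lsc_regularization R (LipW e) (@R_Theta L) f.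

Definition native (e : V) (L : nat) : set (V -> R) :=
  [set val (f : Lip R d) | f in [set f : Lip R d | (R_native (e := e) L f < +oo)%E]].

Definition polyhedron (P : set V) : Prop :=
  exists (m : nat) (A : 'M[R]_(m, d)) (b : 'cV[R]_m),
    P = [set x | forall i, (A *m x) i ord0 <= b i ord0].

Definition affine_on (P : set V) (f : V -> R) : Prop :=
  exists (w : 'rV[R]_d) (c : R), forall x, P x -> f x = (w *m x) ord0 ord0 + c.

Definition CPWL : set (V -> R) :=
  [set f | continuous f /\
    exists (n : nat) (P : 'I_n -> set V),
      [/\ \bigcup_i P i = setT, forall i, polyhedron (P i) &
          forall i, affine_on (P i) f]].

End NativeSpaces.

(* Main.v *)
Require Import Defs.
From mathcomp Require Import all_boot all_order all_algebra.
From mathcomp Require Import all_classical all_reals all_analysis.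
From mathcomp Require Import ring lra.

(* Every f in the depth-2 native space satisfies, for some C, |<m, f>| <= C whenever m is a
   molecule that is at most 1 on all ridges max(0, w.x + b) with |w| <= 1: this condition is
   weak* closed and holds for shallow networks of bounded cost.  Testing against averages,
   over many scales t and base points, of second differences with step t a shows that the
   jump of the derivative of f in direction a takes the same value at any two points where
   it is locally constant, since a ridge contributes substantially at only boundedly many
   scales unless it is constant along the line joining the two points.

   If f is moreover piecewise linear, it is affine on the cells of a finite hyperplane
   arrangement.  Its jump across one of the hyperplanes is constant, so subtracting a ridge
   removes that hyperplane; by induction f is a sum of ridges and an affine function.  The
   same constancy excludes max(0, max(0, x_1) - max(0, x_0)), which has depth 3 and whose
   kink along {x_0 = 0} is present only for x_1 > 0.  Finally, depth 2 embeds into depth 3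
   at bounded extra cost by f = relu f - relu (- f). *)

Set Implicit Arguments.
Unset Strict Implicit.
Unset Printing Implicit Defensive.

Import Order.TTheory GRing.Theory Num.Theory.
Import numFieldNormedType.Exports.

Local Open Scope classical_set_scope.
Local Open Scope ring_scope.

(** * Ridge functions *)

Section Ridge.
Variables (R : realType) (d : nat).
Implicit Types (w : 'rV[R]_d) (x y z v a : 'cV[R]_d).

Definition dot w x : R := (w *m x) ord0 ord0.

Lemma dotD w x y : dot w (x + y) = dot w x + dot w y.
Proof. by rewrite /dot mulmxDr mxE. Qed.

Lemma dotB w x y : dot w (x - y) = dot w x - dot w y.
Proof. by rewrite /dot mulmxBr !mxE. Qed.

Lemma dotZ w t x : dot w (t *: x) = t * dot w x.
Proof. by rewrite /dot -scalemxAr mxE. Qed.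

Lemma dotDl w w' x : dot (w + w') x = dot w x + dot w' x.
Proof. by rewrite /dot mulmxDl mxE. Qed.

Lemma dotNl w x : dot (- w) x = - dot w x.
Proof. by rewrite /dot mulNmx mxE. Qed.

Lemma dotZl t w x : dot (t *: w) x = t * dot w x.
Proof. by rewrite /dot -scalemxAl mxE. Qed.

Lemma dot_tr_gt0 w : w != 0 -> 0 < dot w w^T.
Proof.
move=> w0; have [i wi] : exists i, w ord0 i != 0.
  apply/existsP; apply: contraNT w0 => /existsPn H.
  by apply/eqP/rowP => i; have /negPn/eqP := H i; rewrite !mxE.
rewrite /dot mxE (bigD1 i) //= mxE -expr2 ltr_wpDr ?exprn_even_gt0 //.
by apply: sumr_ge0 => j _; rewrite mxE -expr2 sqr_ge0.
Qed.

Lemma norm2_ge0 n (x : 'cV[R]_n) : 0 <= norm2 x.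
Proof. exact: sqrtr_ge0. Qed.

Lemma coord_le_norm2 n (x : 'cV[R]_n) i : `|x i ord0| <= norm2 x.
Proof.
rewrite -sqrtr_sqr /norm2 ler_sqrt ?sumr_ge0// => [|j _]; rewrite ?sqr_ge0//.
by rewrite (bigD1 i) //= lerDl sumr_ge0 // => j _; rewrite sqr_ge0.
Qed.

Lemma norm2_sqr n (x : 'cV[R]_n) : norm2 x ^+ 2 = \sum_i x i ord0 ^+ 2.
Proof. by rewrite sqr_sqrtr // sumr_ge0 // => i _; rewrite sqr_ge0. Qed.

Lemma dot_le_norml w x : `|dot w x| <= (\sum_i `|x i ord0|) * norm2 w^T.
Proof.
rewrite /dot mxE mulr_suml (le_trans (ler_norm_sum _ _ _)) // ler_sum // => i _.
by rewrite normrM mulrC ler_wpM2l //; have := coord_le_norm2 w^T i; rewrite mxE.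
Qed.

Lemma dot_le_normr w x : `|dot w x| <= (\sum_i `|w ord0 i|) * norm2 x.
Proof.
rewrite /dot mxE mulr_suml (le_trans (ler_norm_sum _ _ _)) // ler_sum // => i _.
by rewrite normrM ler_wpM2l // coord_le_norm2.
Qed.

Lemma relu_lipschitz (s t : R) : `|Num.max 0 s - Num.max 0 t| <= `|s - t|.
Proof.
by rewrite ler_norml /Num.max; do 2 case: ltP => ?; case: (ger0P (s - t)) => ?;
  apply/andP; split; lra.
Qed.

(** Affine parts cancel in a second difference, so only the kink at 0 is left: it shows up exactly
    when [u] is within [|h|] of it. *)
Lemma relu_second_difference (u h : R) :
  Num.max 0 (u + h) + Num.max 0 (u - h) - 2 * Num.max 0 u =
  Num.max 0 (`|h| - `|u|).
Proof.
wlog h0 : h / 0 <= h.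
  move=> H; have [/H //|h0] := lerP 0 h.
  by have := H (- h); rewrite oppr_ge0 normrN opprK addrAC ltW // => <-; ring.
rewrite (ger0_norm h0); have [u0|u0] := lerP 0 u.
  rewrite (ger0_norm u0); have [uh|uh] := lerP u h.
  - by rewrite max_r; first rewrite max_l; first rewrite max_r; lra.
  - by rewrite max_r; first rewrite max_r; first rewrite max_l; lra.
rewrite (ltr0_norm u0); have [uh|uh] := lerP 0 (u + h).
- by rewrite max_l; first rewrite max_r; lra.
- by rewrite max_l; first rewrite max_l; lra.
Qed.

Definition ridge w b x : R := Num.max 0 (dot w x + b).

Lemma ridge_lipschitz w b x y :
  `|ridge w b x - ridge w b y| <= (\sum_i `|w ord0 i|) * norm2 (x - y).
Proof.
apply: le_trans (relu_lipschitz _ _) _.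
have -> : dot w x + b - (dot w y + b) = dot w (x - y) by rewrite dotB; ring.
exact: dot_le_normr.
Qed.

(** Neurons [(c, w, b)] form a list rather than matrices, so that adding or removing a single ridge
    is a list operation. *)
Definition shallow (s : seq (R * 'rV[R]_d * R)) (c0 : R) x : R :=
  \sum_(u <- s) u.1.1 * ridge u.1.2 u.2 x + c0.

(** Unlike the sum of squared weights, this is invariant under replacing a neuron [(c, w, b)] by
    [(c / t, t w, t b)] with [t > 0], which leaves the function unchanged. *)
Definition path_norm (s : seq (R * 'rV[R]_d * R)) : R :=
  \sum_(u <- s) `|u.1.1| * norm2 u.1.2^T.

Lemma shallow_cons u s c0 x :
  shallow (u :: s) c0 x = u.1.1 * ridge u.1.2 u.2 x + shallow s c0 x.
Proof. by rewrite /shallow big_cons addrA. Qed.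

Lemma shallow_affine w c :
  shallow [:: (1, w, 0); (-1, - w, 0)] c = fun x => dot w x + c.
Proof.
apply/funext => x; rewrite !shallow_cons /shallow big_nil /ridge /= dotNl !addr0.
by rewrite /Num.max; do 2 case: ltP => ?; lra.
Qed.

Lemma shallow_lipschitz s c0 : @lipschitz2 R d (shallow s c0).
Proof.
exists (\sum_(u <- s) `|u.1.1| * (\sum_i `|u.1.2 ord0 i|)) => x y.
have -> : shallow s c0 x - shallow s c0 y =
    \sum_(u <- s) u.1.1 * (ridge u.1.2 u.2 x - ridge u.1.2 u.2 y).
  rewrite /shallow opprD addrACA subrr addr0 -sumrB.
  by apply: eq_bigr => u _; rewrite mulrBr.
rewrite mulr_suml (le_trans (ler_norm_sum _ _ _)) // ler_sum // => u _.
by rewrite normrM -mulrA ler_wpM2l // ridge_lipschitz.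
Qed.

Lemma pairing_ext (s : combination R d) g h : g =1 h -> pairing s g = pairing s h.
Proof. by move=> gh; apply: eq_bigr => t _; rewrite !gh. Qed.

Lemma pairing_lin (s : combination R d) c g h :
  pairing s (fun x => c * g x + h x) = c * pairing s g + pairing s h.
Proof.
rewrite /pairing mulr_sumr -big_split /=; apply: eq_bigr => t _; ring.
Qed.

Lemma pairing_cst (s : combination R d) c : pairing s (fun=> c) = 0.
Proof. by apply: big1 => t _; rewrite subrr mulr0. Qed.

(* By the bipolar theorem these are the weak* limits of shallow networks of path norm at
   most [C]. *)
Definition tested_by (C : R) (h : 'cV[R]_d -> R) : Prop :=
  forall (s : combination R d) (B : R), 0 <= B ->
    (forall w b, `|pairing s (ridge w b)| <= B * norm2 w^T) ->
    `|pairing s h| <= C * B.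

Lemma tested_by_ridge C h c w b : tested_by C h ->
  tested_by (`|c| * norm2 w^T + C) (fun x => c * ridge w b x + h x).
Proof.
move=> Ch s B B0 sB; rewrite pairing_lin (le_trans (ler_normD _ _)) //.
rewrite mulrDl lerD ?Ch // normrM -mulrA ler_wpM2l // mulrC; exact: sB.
Qed.

Lemma tested_by_shallow s c0 : tested_by (path_norm s) (shallow s c0).
Proof.
elim: s => [|u s IH].
  move=> s B _ _; rewrite (@pairing_ext _ _ (fun=> c0)) ?pairing_cst.
    by rewrite /path_norm big_nil mul0r normr0.
  by move=> x; rewrite /shallow big_nil add0r.
rewrite /path_norm big_cons (_ : shallow _ _ = fun x => u.1.1 * ridge u.1.2 u.2 x + shallow s c0 x).
  exact: tested_by_ridge.
by apply/funext => x; rewrite shallow_cons.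
Qed.

Lemma tested_by_le C C' h : C <= C' -> tested_by C h -> tested_by C' h.
Proof.
by move=> CC Ch s B B0 sB; apply: le_trans (Ch s B B0 sB) _; rewrite ler_wpM2r.
Qed.

End Ridge.

(** * Jumps of the derivative *)

Section Jump.
Variables (R : realType) (d : nat).
Implicit Types (w : 'rV[R]_d) (x y z v a : 'cV[R]_d) (h : 'cV[R]_d -> R).

Definition second_difference h x u : R := h (x + u) + h (x - u) - 2 * h x.

(** [t] is the value of the ridge argument at the base point and [u] its change over one step; the
    tent vanishes once the kink is out of reach. *)
Definition tent (u t : R) : R := Num.max 0 (`|u| - `|t|).

Lemma second_difference_ridge w b x u :
  second_difference (ridge w b) x u = tent (dot w u) (dot w x + b).
Proof.
by rewrite /second_difference /ridge dotB dotD !(addrAC _ _ b) relu_second_difference.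
Qed.

Lemma tent_ge0 u t : 0 <= tent u t.
Proof. by rewrite /tent le_max lexx. Qed.

Lemma tent_le u t : tent u t <= `|u|.
Proof. by rewrite /tent ge_max normr_ge0 /= gerBl normr_ge0. Qed.

Lemma tent_eq0 u t : `|u| <= `|t| -> tent u t = 0.
Proof. by move=> ut; rewrite /tent max_l // subr_le0. Qed.

Lemma tent_lipschitz u t t' : `|tent u t - tent u t'| <= `|t - t'|.
Proof.
apply: le_trans (relu_lipschitz _ _) _.
rewrite (_ : _ - _ - _ = `|t'| - `|t|); last by ring.
by rewrite [leRHS]distrC ler_dist_dist.
Qed.

Lemma sum_at_most_one (N : nat) (B : pred nat) :
  (forall j k, (j < k < N)%N -> B j -> B k -> False) ->
  \sum_(k < N) (B k)%:R <= 1 :> R.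
Proof.
elim: N => [|N IH] B1; first by rewrite big_ord0.
rewrite big_ord_recr /=; case BN: (B N); last first.
  by rewrite addr0 IH // => j k /andP[jk kN]; apply: B1; rewrite jk ltnS ltnW.
rewrite big1 ?add0r // => i _; case Bi: (B i) => //.
by case: (B1 i N); rewrite ?ltn_ord ?leqnn.
Qed.

(* The scales decrease so fast relative to the spacing of the base points that a ridge of
   slope [alpha] along the axis is visible at one intermediate scale at most: at much coarser
   scales it looks parallel to the axis, so its two tents nearly cancel, and at much finer
   ones its tents are too narrow to reach two base points. *)
Section Scales.
Variables (eta : R) (N : nat).
Hypotheses (eta0 : 0 < eta) (eta1 : eta <= 1) (N0 : (0 < N)%N).

Let step : R := eta / N.+1%:R.
Let ratio : R := step / (2 * N%:R).
Let pos (k : nat) : R := step * k.+1%:R.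
Let scale (k : nat) : R := eta / 2 * ratio ^+ k.

Let step_gt0 : 0 < step. Proof. by rewrite divr_gt0. Qed.
Let ratio_gt0 : 0 < ratio. Proof. by rewrite divr_gt0 // mulr_gt0 // ltr0n. Qed.

Let N1 : 1 <= N%:R :> R. Proof. by rewrite ler1n. Qed.

Let step_le1 : step <= 1.
Proof. by rewrite ler_pdivrMr ?ltr0Sn // mul1r (le_trans eta1) // ler1n. Qed.

Let ratioE : ratio * (2 * N%:R) = step.
Proof. by rewrite divfK // mulf_neq0 // pnatr_eq0 -lt0n. Qed.

Let ratio_le1 : ratio <= 1.
Proof. by have := ratioE; have := ratio_gt0; have := N1; have := step_le1; nra. Qed.

Let pos_gt0 k : 0 < pos k. Proof. by rewrite mulr_gt0. Qed.

Let pos_lt k : (k < N)%N -> pos k < eta.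
Proof.
move=> kN; rewrite /pos /step mulrAC ltr_pdivrMr ?ltr0Sn // ltr_pM2l // ltr_nat.
by rewrite ltnS.
Qed.

Let pos_sep j k : (j < k)%N -> step <= pos k - pos j.
Proof.
move=> jk; rewrite -mulrBr -{1}[step]mulr1 ler_wpM2l ?(ltW step_gt0) //.
by rewrite lerBrDr nat1r ler_nat ltnS.
Qed.

Let scale_gt0 k : 0 < scale k.
Proof. by rewrite mulr_gt0 ?divr_gt0 // exprn_gt0. Qed.

Let scale_lt k : scale k < eta.
Proof.
have H : ratio ^+ k <= 1 by rewrite exprn_ile1 // ltW.
have : scale k <= eta / 2 by rewrite ler_piMr // ltW // divr_gt0.
by move: eta0; lra.
Qed.

Let scale_sep j k : (j < k)%N -> scale k <= ratio * scale j.
Proof.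
move=> jk; rewrite /scale mulrCA ler_pM2l ?divr_gt0 // -exprS.
by rewrite ler_wiXn2l // ltW.
Qed.

(* The zero of [alpha * s + gamma] is within [M * scale k / m] of [pos k]; when this is less
   than half a step for two indices, the indices agree. *)
Lemma crossing_unique (m M alpha gamma : R) : 0 <= M -> m = `|alpha| ->
  \sum_(k < N) ((2 * M * scale k < step * m) &&
                (`|alpha * pos k + gamma| < M * scale k))%:R <= 1 :> R.
Proof.
move=> M0 mE; apply: (sum_at_most_one (B := fun k => (2 * M * scale k < step * m) &&
                (`|alpha * pos k + gamma| < M * scale k))) => j k /andP[jk _].
move=> /andP[j1 j2] /andP[k1 k2].
have H : `|alpha * (pos k - pos j)| < step * m.
  have -> : alpha * (pos k - pos j) = alpha * pos k + gamma - (alpha * pos j + gamma).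
    by ring.
  by apply: le_lt_trans (ler_normB _ _) _; lra.
have := pos_sep jk; move: H; rewrite normrM -mE => H sk.
have : m * step <= m * `|pos k - pos j|.
  by rewrite ler_wpM2l ?mE // (le_trans sk) // ler_norm.
by lra.
Qed.

(** The ends [step * m / 2] and [N * m] of this half-open window for [M * scale k] differ by the
    factor [ratio]. Successive scales shrink by at least that factor, so no two of them fit. *)
Lemma intermediate_unique (m M : R) : 0 <= M -> 0 <= m ->
  \sum_(k < N) ((step * m <= 2 * M * scale k) && (M * scale k < N%:R * m))%:R
    <= 1 :> R.
Proof.
move=> M0 m0; apply: (sum_at_most_one (B := fun k =>
  (step * m <= 2 * M * scale k) && (M * scale k < N%:R * m))) => j k /andP[jk _].
move=> /andP[_ j2] /andP[k1 _].
have H1 : M * scale k <= M * (ratio * scale j) by rewrite ler_wpM2l // scale_sep.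
have H2 : ratio * (M * scale j) < ratio * (N%:R * m) by rewrite ltr_pM2l.
by rewrite -ratioE in k1; lra.
Qed.

(** The summands stand for coarse scales, where the shift by [alpha] is at most an [N]-th of the
    tent height, for intermediate scales, and for fine scales at which the first or the second base
    point is near the kink. Outside the first case the trivial bound [|beta|] is used. *)
Lemma tent_difference_le (alpha beta gamma : R) k : (k < N)%N ->
  `|(scale k)^-1 * (tent (scale k * beta) (alpha * pos k + gamma) -
      tent (scale k * beta) (alpha * pos k + (gamma + alpha)))| <=
  `|beta| * (N%:R^-1 +
    ((step * `|alpha| <= 2 * `|beta| * scale k) && (`|beta| * scale k < N%:R * `|alpha|))%:R +
    ((2 * `|beta| * scale k < step * `|alpha|) &&
                (`|alpha * pos k + gamma| < `|beta| * scale k))%:R +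
    ((2 * `|beta| * scale k < step * `|alpha|) &&
                (`|alpha * pos k + (gamma + alpha)| < `|beta| * scale k))%:R).
Proof.
move=> kN; set t := scale k; have t0 : 0 < t := scale_gt0 k.
set m := `|alpha|; set M := `|beta|.
have M0 : 0 <= M by rewrite normr_ge0.
have m0 : 0 <= m by rewrite normr_ge0.
set T1 := tent _ _; set T2 := tent _ _.
have Nt : `|t * beta| = M * t by rewrite normrM (gtr0_norm t0) mulrC.
have T1le : T1 <= M * t by rewrite -Nt tent_le.
have T2le : T2 <= M * t by rewrite -Nt tent_le.
have T10 : 0 <= T1 := tent_ge0 _ _.
have T20 : 0 <= T2 := tent_ge0 _ _.
have Tm : `|T1 - T2| <= m.
  apply: le_trans (tent_lipschitz _ _ _) _.
  by rewrite (_ : _ - _ = - alpha) ?normrN //; ring.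
rewrite normrM (gtr0_norm (_ : 0 < t^-1)) ?invr_gt0 // ler_pdivrMl //.
have TM : `|T1 - T2| <= M * t by rewrite ler_norml; apply/andP; split; lra.
have Ninv : 0 <= N%:R^-1 :> R by rewrite invr_ge0 ler0n.
have X : 0 <= M * t by rewrite mulr_ge0 // ltW.
have big r : 1 <= r -> `|T1 - T2| <= t * (M * r).
  by move=> r1; apply: le_trans TM _; rewrite [leRHS]mulrA [t * M]mulrC ler_peMr.
have [c1|c1] := leP (step * m) (2 * M * t); rewrite /= ?addr0.
  have [c2|c2] := ltP (M * t) (N%:R * m); rewrite ?addr0 /=.
    by apply: big; rewrite lerDr.
  rewrite mulrA [t * M]mulrC; apply: le_trans Tm _.
    by rewrite ler_pdivlMr ?ltr0n // [m * _]mulrC.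
rewrite ltNge; have [c2|c2] /= := leP (M * t) `|alpha * pos k + gamma|;
  rewrite ?add0r ?addr0 ltNge; have [c3|c3] /= := leP (M * t) `|alpha * pos k + (gamma + alpha)|;
  rewrite ?add0r ?addr0.
(* At a fine scale with both base points away from the kink, both tents vanish. *)
- by rewrite /T1 /T2 !tent_eq0 ?Nt // subrr normr0 mulrA [t * M]mulrC mulr_ge0.
all: apply: big; lra.
Qed.

(** Two dipoles make a second difference, here at [x] and, with opposite sign, at [y = x + v].
    Division by the scale gives a kink the same weight at every scale. *)
Let atoms (a z v : 'cV[R]_d) (k : nat) : combination R d :=
  let x := z + pos k *: v in let y := z + v + pos k *: v in let u := scale k *: a in
  [:: ((scale k)^-1, (x + u, x)); ((scale k)^-1, (x - u, x));
      (- (scale k)^-1, (y + u, y)); (- (scale k)^-1, (y - u, y))].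

Let test a z v : combination R d := flatten [seq atoms a z v k | k <- index_iota 0 N].

Let pairing_test a z v g : pairing (test a z v) g =
  \sum_(k < N) (scale k)^-1 * (second_difference g (z + pos k *: v) (scale k *: a) -
     second_difference g (z + v + pos k *: v) (scale k *: a)).
Proof.
rewrite /pairing /test big_flatten big_map big_mkord; apply: eq_bigr => k _.
by rewrite /atoms !big_cons big_nil /= /second_difference; ring.
Qed.

(** On [h] each of the [N] scales contributes [c - c'] to the test molecule. On a ridge each of the
    four summands of [tent_difference_le] adds up to at most 1 over all scales, which gives the
    factor 4, independent of [N]. *)
Lemma jump_difference_le C h a z v (c c' : R) : tested_by C h ->
  (forall s t : R, 0 < s < eta -> 0 < t < eta ->
     second_difference h (z + s *: v) (t *: a) = c * t) ->
  (forall s t : R, 0 < s < eta -> 0 < t < eta ->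
     second_difference h (z + v + s *: v) (t *: a) = c' * t) ->
  N%:R * `|c - c'| <= C * (4 * \sum_i `|a i ord0|).
Proof.
move=> Ch Hc Hc'; have := Ch (test a z v) (4 * \sum_i `|a i ord0|).
rewrite pairing_test.
have -> : \sum_(k < N) (scale k)^-1 * (second_difference h (z + pos k *: v) (scale k *: a) -
     second_difference h (z + v + pos k *: v) (scale k *: a)) = N%:R * (c - c').
  rewrite -[N in N%:R]card_ord -sum1_card natr_sum mulr_suml; apply: eq_bigr => k _.
  rewrite Hc ?Hc' ?pos_gt0 ?pos_lt ?scale_gt0 ?scale_lt //.
  by rewrite mul1r -mulrBl mulrC mulfK // gt_eqF.
rewrite normrM normr_nat; apply; first by rewrite mulr_ge0 // sumr_ge0.
move=> w b; rewrite pairing_test -mulrA.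
have wa := dot_le_norml w a.
apply: (@le_trans _ _ (4 * `|dot w a|)); last by rewrite ler_wpM2l.
apply: le_trans (ler_norm_sum _ _ _) _.
set gamma := dot w z + b.
have {}H (k : 'I_N) := @tent_difference_le (dot w v) (dot w a) gamma k (ltn_ord k).
rewrite (eq_bigr (fun k : 'I_N => `|(scale k)^-1 *
    (tent (scale k * dot w a) (dot w v * pos k + gamma) -
     tent (scale k * dot w a) (dot w v * pos k + (gamma + dot w v)))|)); last first.
  move=> k _; rewrite !second_difference_ridge !dotD !dotZ /gamma.
  by congr (`| _ * (tent _ _ - tent _ _)|); ring.
apply: le_trans (ler_sum _ (fun k _ => H k)) _.
rewrite -mulr_sumr mulrC ler_wpM2r // !big_split /=.
rewrite sumr_const card_ord.
have -> : N%:R^-1 *+ N = 1 :> R.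
  by rewrite -[LHS]mulr_natr mulVf // pnatr_eq0 -lt0n.
have := @crossing_unique `|dot w v| `|dot w a| (dot w v) gamma (normr_ge0 _) erefl.
have := @crossing_unique `|dot w v| `|dot w a| (dot w v) (gamma + dot w v) (normr_ge0 _) erefl.
have := @intermediate_unique `|dot w v| `|dot w a| (normr_ge0 _) (normr_ge0 _).
by lra.
Qed.

End Scales.

(** The bound on [N%:R * |c - c'|] does not depend on [N], so a large [N] contradicts [c != c']. *)
Lemma jump_constant C h a z v (eta c c' : R) : 0 < eta -> tested_by C h ->
  (forall s t : R, 0 < s < eta -> 0 < t < eta ->
     second_difference h (z + s *: v) (t *: a) = c * t) ->
  (forall s t : R, 0 < s < eta -> 0 < t < eta ->
     second_difference h (z + v + s *: v) (t *: a) = c' * t) ->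
  c = c'.
Proof.
move=> eta0 Ch Hc Hc'; apply/eqP; rewrite -subr_eq0 -normr_le0 leNgt; apply/negP => cc.
set B := C * (4 * \sum_i `|a i ord0|).
have [N HN] : exists N, B < N%:R * `|c - c'|.
  exists (Num.truncn (B / `|c - c'|)).+1; rewrite -ltr_pdivrMr //.
  exact: truncnS_gt.
(* The scales were built for [eta <= 1]; shrinking [eta] keeps both hypotheses on [h]. *)
have := @jump_difference_le (Num.min 1 eta) N.+1 _ _ _ C h a z v c c' Ch.
have -> : (0 < Num.min 1 eta) by rewrite lt_min ltr01.
have -> : (Num.min 1 eta <= 1) by rewrite ge_min lexx.
have E (s : R) : 0 < s < Num.min 1 eta -> 0 < s < eta.
  by rewrite lt_min => /andP[-> /andP[_ ->]].
move=> /(_ isT isT isT (fun s t hs ht => Hc s t (E s hs) (E t ht))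
  (fun s t hs ht => Hc' s t (E s hs) (E t ht))).
rewrite -/B leNgt => /negP; apply; apply: lt_le_trans HN _.
by rewrite ler_wpM2r // ler_nat.
Qed.

End Jump.

(** * The weak* topology *)

Section WeakStar.
Variables (R : realType) (d : nat) (e : 'cV[R]_d).

Lemma combination_cost_ge0 (s : combination R d) : 0 <= combination_cost s.
Proof. by apply: sumr_ge0 => t _; rewrite mulr_ge0 ?norm2_ge0. Qed.

Lemma ae_norm0 : ae_norm (fun _ : 'cV[R]_d => 0) <= 0.
Proof.
apply: inf_lbound.
  by exists 0 => _ [s _ <-]; exact: combination_cost_ge0.
exists [::]; first by apply/funext => p; rewrite /molecule big_nil.
by rewrite /combination_cost big_nil.
Qed.

Lemma ae_cauchy_cst (s : combination R d) : ae_cauchy (fun=> s).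
Proof.
move=> eps eps0; exists 0 => m n _ _; apply: le_lt_trans eps0.
apply: le_trans ae_norm0; rewrite (_ : (fun p => _) = (fun=> 0)) //.
by apply/funext => p; rewrite subrr.
Qed.

Lemma wstar_functional_continuous i :
  continuous (wstar_functional e i : LipW e -> R).
Proof.
move=> f; have /cvg_sup/(_ i) H : nbhs f --> (f : LipW e) by [].
move=> A /(@initial_continuous _ _ (wstar_functional e i) f) /H; exact.
Qed.

(** A finite combination is an element of [AE] through its constant sequence, and pairing ignores
    the subtracted constant [f e]. *)
Lemma pairing_continuous (s : combination R d) :
  continuous ((fun f : Lip R d => pairing s (val f)) : LipW e -> R).
Proof.
rewrite (_ : (fun f => _) = wstar_functional e (Some (MkAE (ae_cauchy_cst s)))).
  exact: wstar_functional_continuous.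
apply/funext => f; rewrite /= /ae_pairing /= lim_cst // /pairing.
by apply: eq_bigr => t _; congr (_ * _); ring.
Qed.

(** An intersection of closed conditions, each on one weak* continuous pairing. *)
Lemma tested_by_closed C : closed [set f : LipW e | tested_by C (val (f : Lip R d))].
Proof.
rewrite (_ : mkset _ = \bigcap_(sB in [set sB : combination R d * R |
    0 <= sB.2 /\ forall w b, `|pairing sB.1 (ridge w b)| <= sB.2 * norm2 w^T])
  [set f : LipW e | `|pairing sB.1 (val (f : Lip R d))| <= C * sB.2]).
  apply: closed_bigI => -[s B] _ /=.
  have := @preimage_closed _ _ (fun f : LipW e => `|pairing s (val (f : Lip R d))|)
    [set x : R | x <= C * B] _ (@closed_le _ _); apply=> f _.
  by apply: continuous_comp; [exact: pairing_continuous|exact: norm_continuous].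
apply/seteqP; split => f /=; first by move=> H [s B] [B0 HB]; exact: H.
by move=> H s B B0 HB; apply: (H (s, B)).
Qed.

Section Native.
Variable L : nat.

Lemma lsc_regularization_le (T : topologicalType) (K : T -> \bar R) x :
  (lsc_regularization K x <= K x)%E.
Proof. by have [_ + _] := lsc_regularization_largest K; exact. Qed.

Lemma native_realizable f (fL : f \in @lipschitz2 R d) :
  realizable L f -> native e L f.
Proof.
move=> [theta thetaf]; exists (exist _ f fL) => //=.
apply: le_lt_trans (@lsc_regularization_le (LipW e) _ _) _.
apply: (@le_lt_trans _ _ (param_cost theta)%:E); last by rewrite ltry.
by apply: ereal_inf_lbound; exists theta.
Qed.

Lemma native_lipschitz f : native e L f -> @lipschitz2 R d f.
Proof. by move=> [[g gL] _ <-]; have := gL; rewrite inE. Qed.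

Lemma weight_sum_ge0 k l (theta : network R k l) : 0 <= weight_sum theta.
Proof.
elim: theta => [k' W b|k' k'' l' W b theta IH] /=; rewrite ?addr_ge0 // /frobenius2;
  by apply: sumr_ge0 => i _; apply: sumr_ge0 => j _; rewrite sqr_ge0.
Qed.

(* The function that is 0 on the closed set [tested_by C] and [C] elsewhere is l.s.c. and
   lies below [R_Theta L]. *)
Lemma native_tested f :
  (forall theta : network R d L, tested_by (param_cost theta) (realization theta)) ->
  native e L f -> exists C, tested_by C f.
Proof.
move=> HL [g]; rewrite /= => gfin <-; apply: contrapT => nex.
move: gfin; rewrite ltNge => /negP; apply; rewrite leye_eq; apply/eqP.
(* If no constant tests [g], then for every [A > 0] the minorant attached to [A] equals [A] at [g],
   so the regularization is infinite there. *)
apply/eqyP => A A0; apply: ereal_sup_ubound.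
pose S := [set f : LipW e | tested_by A (val (f : Lip R d))].
exists (fun f : LipW e => if f \in S then 0%E else A%:E); last first.
  case: ifPn => //; rewrite inE /S /= => gA; by case: nex; exists A.
split=> [a|h] /=.
  have [a0|a0] := ltP a 0.
    rewrite (_ : mkset _ = set0); first exact: closed0.
    apply/seteqP; split => // h /=; case: ifP => _.
      by rewrite lee_fin leNgt a0.
    by rewrite lee_fin leNgt (lt_trans a0 A0).
  have [aA|aA] := ltP a A.
    rewrite (_ : mkset _ = S); first exact: tested_by_closed.
    apply/seteqP; split => h /=; case: ifPn; rewrite ?inE // lee_fin leNgt ?aA //.
    by move=> /negP; rewrite inE.
  rewrite (_ : mkset _ = setT); first exact: closedT.
  by apply/seteqP; split => h //= _; case: ifP => _; rewrite lee_fin.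
apply: le_ereal_inf_tmp => _ [theta /= thetah <-]; case: ifPn => hS; rewrite lee_fin.
  by rewrite mulr_ge0 ?invr_ge0 ?weight_sum_ge0.
rewrite leNgt; apply/negP => costA; move/negP: hS; rewrite inE; apply.
by rewrite /S /= -thetah; apply: tested_by_le (HL theta); exact: ltW.
Qed.

End Native.

Local Open Scope ereal_scope.

(** An l.s.c. minorant [g] of [R_Theta L'] yields the l.s.c. minorant [a^-1 g - 1] of [R_Theta L],
    so the comparison of costs passes to the regularizations. *)
Lemma native_le (L L' : nat) (a : R) : (0 < a)%R ->
  (forall f : Lip R d, R_Theta L' f <= a%:E * (R_Theta L f + 1)) ->
  native e L `<=` native e L'.
Proof.
move=> a0 LL _ [f ffin <-]; exists f => //=; move: ffin; rewrite /= => ffin.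
have key (g : LipW e -> \bar R) : lsc g -> (forall h, g h <= R_Theta L' h) ->
    g f <= a%:E * (R_native (e := e) L f + 1).
  move=> lg gL; rewrite -lee_pdivrMl // -leeBlDr //.
  have [_ _ H] := @lsc_regularization_largest R (LipW e) (@R_Theta R d L).
  apply: (H (fun h => a^-1%:E * g h - 1)).
    move=> b; rewrite (_ : mkset _ = [set h | g h <= (a * (b + 1))%:E]); first exact: lg.
    apply/seteqP; split => h; rewrite /mkset leeBlDr // lee_pdivrMl // -EFinD -EFinM.
  by move=> h; rewrite leeBlDr // lee_pdivrMl //; exact: le_trans (gL h) (LL h).
apply: (@le_lt_trans _ _ (a%:E * (R_native (e := e) L f + 1))).
  by apply: ge_ereal_sup => _ [g [lg gL] <-]; exact: key.
by rewrite lte_mul_pinfty ?lee_fin ?ltW // ?lte_add_pinfty ?ltry.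
Qed.

End WeakStar.

(** * Hyperplane arrangements *)

Section Arrangement.
Variables (R : realType) (d : nat).
Implicit Types (w n : 'rV[R]_d) (x y z u v a : 'cV[R]_d) (h : 'cV[R]_d -> R).
Implicit Types (A : seq ('rV[R]_d * R)).

(* [(n, b)] encodes the hyperplane [dot n x = b]. *)
Definition same_side A x y : Prop :=
  forall p, p \in A -> 0 < (dot p.1 x - p.2) * (dot p.1 y - p.2).

Lemma mul_gt0_trans (r s t : R) : 0 < r * s -> 0 < r * t -> 0 < s * t.
Proof.
move=> rs rt; have r0 : r != 0 by apply: contraTneq rs => ->; rewrite mul0r ltxx.
have E : r ^+ 2 * (s * t) = r * s * (r * t) by ring.
have : 0 < r ^+ 2 * (s * t) by rewrite E mulr_gt0.
by rewrite pmulr_rgt0 // exprn_even_gt0.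
Qed.

(** Strict signs make this a partial equivalence: [same_side A x x] says that [x] lies on no
    hyperplane of [A], and the classes are the open cells. *)
Lemma same_side_trans A x y z : same_side A x y -> same_side A x z -> same_side A y z.
Proof. by move=> xy xz p pA; exact: mul_gt0_trans (xy p pA) (xz p pA). Qed.

Lemma same_side_sym A x y : same_side A x y -> same_side A y x.
Proof. by move=> xy p pA; rewrite mulrC xy. Qed.

Lemma same_side_cons p A x y : 0 < (dot p.1 x - p.2) * (dot p.1 y - p.2) ->
  same_side A x y -> same_side (p :: A) x y.
Proof. by move=> p0 xy q; rewrite inE => /predU1P[->//|/xy]. Qed.

Lemma same_side_open A x u v : same_side A x x -> exists2 eta : R, 0 < eta &
  forall s t : R, `|s| < eta -> `|t| < eta -> same_side A x (x + s *: u + t *: v).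
Proof.
elim: A => [|p A IH] xx; first by exists 1.
have [|eta eta0 H] := IH; first by move=> q qA; apply: xx; rewrite inE qA orbT.
set r := dot p.1 x - p.2.
have rr : 0 < r * r by apply: xx; rewrite mem_head.
have r0 : 0 < `|r|.
  by rewrite normr_gt0; apply: contraTneq rr => ->; rewrite mul0r ltxx.
(* Displacements by less than [|r| / m] along [u] and [v] change [r] by less than [|r|], so its sign
   persists. *)
set m := `|dot p.1 u| + `|dot p.1 v| + 1.
have m0 : 0 < m by rewrite ltr_wpDl ?addr_ge0.
exists (Num.min eta (`|r| / m)); first by rewrite lt_min eta0 divr_gt0.
move=> s t; rewrite !lt_min => /andP[s1 s2] /andP[t1 t2].
apply: same_side_cons; last exact: H.
have -> : dot p.1 (x + s *: u + t *: v) - p.2 = r + (s * dot p.1 u + t * dot p.1 v).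
  by rewrite !dotD !dotZ /r; ring.
rewrite -/r; set q := s * _ + _.
have qr : `|q| < `|r|.
  apply: (@le_lt_trans _ _ (`|r| / m * (m - 1))).
    apply: le_trans (ler_normD _ _) _; rewrite !normrM addrK mulrDr.
    by rewrite lerD // ler_wpM2r // ltW.
  by rewrite mulrBr divfK ?gt_eqF // mulr1 ltrBlDr ltrDl divr_gt0.
have : `|r * q| < r * r.
  by rewrite normrM -[ltRHS]gtr0_norm // normrM ltr_pM2l.
by rewrite ltr_norml (mulrDr r r q) -ltrBlDl sub0r => /andP[].
Qed.

(** This carries the affine formula of an open cell to its boundary: the Lipschitz error and the
    change of the affine function along [t *: a] are both linear in [t]. *)
Lemma lipschitz_affine_limit h w c y a (eta : R) : lipschitz2 h -> 0 < eta ->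
  (forall t : R, 0 < t < eta -> h (y + t *: a) = dot w (y + t *: a) + c) ->
  h y = dot w y + c.
Proof.
move=> [k hk] eta0 H; apply/eqP; rewrite -subr_eq0 -normr_le0; apply/ler_addgt0Pl => r r0.
rewrite addr0; set m := `|k| * norm2 a + `|dot w a| + 1.
have m0 : 0 < m by rewrite ltr_wpDl // addr_ge0 // mulr_ge0 // norm2_ge0.
set t := Num.min (eta / 2) (r / m).
have t0 : 0 < t by rewrite lt_min !divr_gt0.
have te : t < eta by rewrite gt_min; apply/orP; left; lra.
have tr : t * m <= r by rewrite -ler_pdivlMr // ge_min lexx orbT.
have Ht : h (y + t *: a) = dot w (y + t *: a) + c by rewrite H // t0.
have : `|h y - h (y + t *: a)| <= t * (`|k| * norm2 a).
  apply: le_trans (hk _ _) _.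
  have -> : y - (y + t *: a) = - t *: a by rewrite opprD addNKr scaleNr.
  have -> : norm2 (- t *: a) = t * norm2 a.
    rewrite /norm2 (eq_bigr (fun i => t ^+ 2 * a i ord0 ^+ 2)) => [|i _].
      by rewrite -mulr_sumr sqrtrM ?sqr_ge0 // sqrtr_sqr gtr0_norm.
    by rewrite mxE exprMn sqrrN.
  by rewrite mulrCA ler_pM2l //; apply: ler_wpM2r (ler_norm k); exact: norm2_ge0.
rewrite Ht dotD dotZ => Hle.
have -> : h y - (dot w y + c) = h y - (dot w y + t * dot w a + c) + t * dot w a by ring.
apply: le_trans (ler_normD _ _) _; apply: le_trans (lerD Hle (lexx _)) _.
rewrite normrM (gtr0_norm t0) -mulrDr; apply: le_trans tr.
by rewrite ler_pM2l // /m lerDl.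
Qed.

(* The two affine pieces of [h] adjacent to the hyperplane agree on it by continuity, so
   they differ by a multiple of its equation. *)
Lemma hyperplane_crossing A n b h z : n != 0 -> lipschitz2 h ->
  (forall x, same_side ((n, b) :: A) x x -> exists w c, forall y,
     same_side ((n, b) :: A) x y -> h y = dot w y + c) ->
  same_side A z z -> dot n z = b ->
  exists k w c, forall y, same_side A z y -> h y = k * ridge n (- b) y + (dot w y + c).
Proof.
move=> n0 hL hA zz nz; set a := n^T; have na : 0 < dot n a := dot_tr_gt0 n0.
have [eta eta0 zeta] := same_side_open a 0 zz.
have zt t : `|t| < eta -> same_side A z (z + t *: a).
  by move=> te; have := zeta t 0 te; rewrite normr0 scaler0 addr0; exact.
have nt x t : dot n x = b -> dot n (x + t *: a) - b = t * dot n a.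
  by move=> <-; rewrite dotD dotZ; ring.
have side t y : t * (dot n y - b) > 0 -> `|t| < eta -> same_side A z y ->
    same_side ((n, b) :: A) (z + t *: a) y.
  move=> ty te zy; apply: same_side_cons; last exact: same_side_trans (zt t te) zy.
  by rewrite /= nt // mulrAC mulr_gt0.
have piece t : t != 0 -> `|t| < eta -> exists w c, forall y, same_side A z y ->
    0 < t * (dot n y - b) -> h y = dot w y + c.
  move=> t0 te; have [|w [c Hwc]] := hA (z + t *: a).
    apply: side => //; last exact: zt.
    by rewrite nt // mulrA mulr_gt0 // -expr2 exprn_even_gt0.
  by exists w, c => y zy ty; apply: Hwc; exact: side.
have e2 : `|eta / 2| < eta by rewrite gtr0_norm ?divr_gt0 //; lra.
have e2N : `|- (eta / 2)| < eta by rewrite normrN.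
have e20 : 0 < eta / 2 by rewrite divr_gt0.
have [|w1 [c1 H1]] := piece (eta / 2) _ e2; first by rewrite gt_eqF.
have [|w2 [c2 H2]] := piece (- (eta / 2)) _ e2N; first by rewrite oppr_eq0 gt_eqF.
have agree y : same_side A z y -> dot n y = b ->
    h y = dot w1 y + c1 /\ h y = dot w2 y + c2.
  move=> zy ny.
  have [r r0 yr] := same_side_open a 0 (same_side_trans zy zy).
  have yt t : `|t| < r -> same_side A z (y + t *: a).
    move=> tr; apply: same_side_trans (same_side_sym zy) _.
    by have := yr t 0 tr; rewrite normr0 scaler0 addr0; exact.
  split.
    apply: (@lipschitz_affine_limit _ _ _ _ a r) => // t /andP[t0 tr].
    by apply: H1; [apply: yt; rewrite gtr0_norm|rewrite nt // !mulr_gt0].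
  apply: (@lipschitz_affine_limit _ _ _ _ (- a) r) => // t /andP[t0 tr].
  rewrite scalerN -scaleNr; apply: H2; first by apply: yt; rewrite normrN gtr0_norm.
  by rewrite nt // mulrA mulrNN !mulr_gt0.
set D := fun y => dot w1 y + c1 - (dot w2 y + c2).
have D0 y : same_side A z y -> dot n y = b -> D y = 0.
  by move=> zy /(agree y zy)[E1 E2]; rewrite /D -E1 -E2 subrr.
set k := (dot w1 a - dot w2 a) / dot n a.
have DE y : D y = k * (dot n y - b).
  (* Write [y = z + tau *: a + u] with [u] parallel to the hyperplane. As [D] vanishes at [z] and at
     a nearby point of the hyperplane in direction [u], its linear part kills [u]. *)
  set tau := (dot n y - b) / dot n a.
  set u := y - z - tau *: a.
  have nu : dot n u = 0 by rewrite /u !dotB dotZ nz divfK ?subrr // gt_eqF.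
  have [r r0 zr] := same_side_open u 0 zz.
  have r2 : `|r / 2| < r by rewrite gtr0_norm ?divr_gt0 //; lra.
  have := D0 (z + r / 2 *: u).
  have -> : dot n (z + r / 2 *: u) = b by rewrite dotD dotZ nu mulr0 addr0.
  have zu : same_side A z (z + r / 2 *: u).
    by have := zr (r / 2) 0 r2; rewrite normr0 scaler0 addr0; exact.
  move=> /(_ zu erefl); have := D0 z zz nz; rewrite /D !dotD !dotZ => Dz Du.
  have {Du} : r / 2 * (dot w1 u - dot w2 u) = 0 by lra.
  move=> /eqP; rewrite mulf_eq0 gt_eqF ?divr_gt0 //= => /eqP.
  rewrite /u !dotB !dotZ => Eu.
  have -> : k * (dot n y - b) = tau * (dot w1 a - dot w2 a).
    by rewrite /k /tau; ring.
  by lra.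
exists k, w2, c2 => y zy; rewrite /ridge /Num.max; case: ifPn => [ny|].
  by rewrite -DE /D (H1 y zy) ?mulr_gt0 //; ring.
rewrite -leNgt le_eqVlt => /predU1P[ny|ny]; rewrite mulr0 add0r.
  by have [] := agree y zy; first by lra.
by apply: H2 => //; rewrite nmulr_rgt0 // oppr_lt0.
Qed.

(** Since [v = z' - z] is parallel to the hyperplane, base points moved along [v] stay on the kink,
    and second differences in the normal direction there read off [k] near [z] and [k'] near
    [z']. *)
Lemma crossing_constant A n b h C z z' k k' w w' (c c' : R) : n != 0 -> tested_by C h ->
  same_side A z z -> dot n z = b -> same_side A z' z' -> dot n z' = b ->
  (forall y, same_side A z y -> h y = k * ridge n (- b) y + (dot w y + c)) ->
  (forall y, same_side A z' y -> h y = k' * ridge n (- b) y + (dot w' y + c')) ->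
  k = k'.
Proof.
move=> n0 hC zz nz zz' nz' H H'; set a := n^T; have na : 0 < dot n a := dot_tr_gt0 n0.
set v := z' - z; have nv : dot n v = 0 by rewrite dotB nz nz' subrr.
have [eta eta0 zeta] := same_side_open v a zz.
have [eta' eta0' zeta'] := same_side_open v a zz'.
suff : k * dot n a = k' * dot n a by apply: mulIf; rewrite gt_eqF.
have jump A' y0 r k0 w0 c0 s t : dot n y0 = b -> 0 < s < r -> 0 < t < r ->
    (forall s t : R, `|s| < r -> `|t| < r -> same_side A' y0 (y0 + s *: v + t *: a)) ->
    (forall y, same_side A' y0 y -> h y = k0 * ridge n (- b) y + (dot w0 y + c0)) ->
    second_difference h (y0 + s *: v) (t *: a) = k0 * dot n a * t.
  move=> ny /andP[s0 sr] /andP[t0 tr] near Hy.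
  have sr' : `|s| < r by rewrite gtr0_norm.
  have tr' : `|t| < r by rewrite gtr0_norm.
  have tr'' : `|- t| < r by rewrite normrN.
  have := second_difference_ridge n (- b) (y0 + s *: v) (t *: a).
  have -> : dot n (y0 + s *: v) + - b = 0 by rewrite dotD dotZ nv ny; ring.
  rewrite dotZ /tent normr0 subr0 normrM (gtr0_norm t0) (gtr0_norm na).
  rewrite max_r ?mulr_ge0 ?ltW // /second_difference => E.
  rewrite !Hy; last 3 first.
  - by have := near s 0 sr'; rewrite normr0 scale0r addr0; apply; exact: lt_trans tr.
  - by rewrite -scaleNr; exact: near.
  - exact: near.
  rewrite -mulrA [dot n a * t]mulrC -E !(dotB, dotD, dotZ); ring.
apply: (@jump_constant R d C h a z v (Num.min eta eta')) => //.
- by rewrite lt_min eta0.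
- move=> s t /andP[s0]; rewrite lt_min => /andP[s1 _] /andP[t0].
  rewrite lt_min => /andP[t1 _]; apply: (@jump A z eta k w c) => //; exact/andP.
- move=> s t /andP[s0]; rewrite lt_min => /andP[_ s1] /andP[t0].
  rewrite lt_min => /andP[_ t1].
  have -> : z + v = z' by rewrite addrC subrK.
  by apply: (@jump A z' eta' k' w' c') => //; exact/andP.
Qed.

(** Induction on the hyperplanes. Subtracting the ridge of the first one keeps [h] Lipschitz and
    tested, with larger constants, and makes it affine on the cells of the remaining arrangement. *)
Lemma arrangement_shallow A h C : (forall p, p \in A -> p.1 != 0) ->
  lipschitz2 h -> tested_by C h ->
  (forall x, same_side A x x -> exists w c, forall y, same_side A x y ->
     h y = dot w y + c) ->
  exists s c0, h = shallow s c0.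
Proof.
elim: A h C => [|[n b] A IH] h C A0 hL hC hA.
  have [//|w [c H]] := hA 0.
  exists [:: (1, w, 0); (-1, - w, 0)], c; rewrite shallow_affine.
  by apply/funext => y; apply: H.
have n0 : n != 0 by apply: (A0 (n, b)); rewrite mem_head.
have [k Hk] : exists k, forall z, same_side A z z -> dot n z = b ->
    exists w c, forall y, same_side A z y -> h y = k * ridge n (- b) y + (dot w y + c).
  have [[z0 [zz0 nz0]]|nex] := pselect (exists z, same_side A z z /\ dot n z = b); last first.
    by exists 0 => z zz nz; case: nex; exists z.
  have [k [w [c H]]] := hyperplane_crossing n0 hL hA zz0 nz0.
  exists k => z zz nz; have [k' [w' [c' H']]] := hyperplane_crossing n0 hL hA zz nz.
  by exists w', c'; rewrite (crossing_constant n0 hC zz0 nz0 zz nz H H').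
have [| | |x xx|s [c0 Hs]] := IH (fun x => (- k) * ridge n (- b) x + h x)
    (`|- k| * norm2 n^T + C).
- by move=> p pA; apply: A0; rewrite inE pA orbT.
- have [l hl] := hL; exists (`|k| * (\sum_i `|n ord0 i|) + l) => x y.
  rewrite (_ : _ - _ = (- k) * (ridge n (- b) x - ridge n (- b) y) + (h x - h y)).
    rewrite (le_trans (ler_normD _ _)) // mulrDl lerD // normrM normrN -mulrA.
    by rewrite ler_wpM2l // ridge_lipschitz.
  by ring.
- exact: tested_by_ridge.
(* A cell crossed by the hyperplane loses its kink by the choice of [k]; any other cell lies on one
   side, where the subtracted ridge is itself affine. *)
- have [[z [xz nz]]|nex] := pselect (exists z, same_side A x z /\ dot n z = b).
    have [w [c H]] := Hk z (same_side_trans xz xz) nz.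
    exists w, c => y xy; rewrite (H y (same_side_trans xz xy)); ring.
  have sameside y : same_side A x y -> 0 < (dot n x - b) * (dot n y - b).
    move=> xy; rewrite ltNge; apply/negP => le0; apply: nex.
    set r := dot n x - b in le0; set q := dot n y - b in le0.
    have [r0|r0] := eqVneq r 0; first by exists x; split => //; rewrite /r in r0; lra.
    have rq : r - q != 0.
      apply: contraTneq le0 => /eqP; rewrite subr_eq0 => /eqP <-.
      by rewrite -ltNge -expr2 exprn_even_gt0.
    (* The parameter at which the segment from [x] to [y] meets the hyperplane; by convexity the
       point lies in the cell of [x], contradicting [nex]. *)
    set t := r / (r - q).
    have t01 : 0 <= t <= 1.
      have rr : 0 < r ^+ 2 by rewrite exprn_even_gt0.
      have dd : 0 < (r - q) ^+ 2 by rewrite exprn_even_gt0.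
      have tE : t * (r - q) ^+ 2 = r * (r - q) by rewrite /t expr2 mulrA divfK.
      by apply/andP; split; nra.
    exists (x + t *: (y - x)); split; last first.
      rewrite dotD dotZ dotB.
      have : t * (r - q) = r by rewrite divfK.
      by rewrite /r /q; lra.
    move=> p pA; have px := xx p pA; have py := xy p pA.
    rewrite dotD dotZ dotB (_ : _ * _ = (1 - t) * ((dot p.1 x - p.2) * (dot p.1 x - p.2)) +
      t * ((dot p.1 x - p.2) * (dot p.1 y - p.2))); last by ring.
    move/andP: t01 => [t0 t1]; have [t2|t2] := ltP 0 t.
      by apply: ltr_wpDl; [apply: mulr_ge0; [lra|exact: ltW]|exact: mulr_gt0].
    by apply: ltr_pwDl; [apply: mulr_gt0 => //; lra|apply: mulr_ge0 => //; exact: ltW].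
  have [|w [c H]] := hA x; first by apply: same_side_cons => //; exact: sameside.
  have {}H y : same_side A x y -> h y = dot w y + c.
    by move=> xy; apply: H; apply: same_side_cons => //; exact: sameside.
  have [nx|nx] := ltP 0 (dot n x - b).
    exists (w - k *: n), (c + k * b) => y xy.
    have ny : 0 < dot n y - b by have := sameside y xy; rewrite pmulr_rgt0.
    by rewrite (H y xy) /ridge max_r ?ltW // dotDl dotNl dotZl; ring.
  exists w, c => y xy.
  have ny : dot n y - b < 0.
    have := sameside y xy; move: nx; rewrite le_eqVlt => /predU1P[->|nx].
      by rewrite mul0r ltxx.
    by rewrite nmulr_rgt0.
  by rewrite (H y xy) /ridge max_l ?ltW //; ring.
exists ((k, n, - b) :: s), c0; apply/funext => x; rewrite shallow_cons -Hs /=; ring.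
Qed.

End Arrangement.

(** * Networks *)

Section Networks.
Variables (R : realType) (d : nat).
Implicit Types (x y : 'cV[R]_d).

Lemma network1P k (theta : network R k 1) :
  exists (W : 'M[R]_(1, k)) (b : 'cV[R]_1), theta = OutputLayer W b.
Proof.
refine (match theta as t in network _ k' l return
  match l as l' return network R k' l' -> Prop with
  | 1%N => fun t => exists W b, t = OutputLayer W b
  | _ => fun _ => True
  end t with
  | OutputLayer k' W b => _
  | HiddenLayer k' k'' l W b t => _
  end); first by exists W, b.
(* A hidden layer at depth 1 would have a tail of depth 0, and there is none. *)
by case: l t => // t; inversion t.
Qed.

Lemma network2P k (theta : network R k 2) :
  exists (k' : nat) (W : 'M[R]_(k', k)) b W2 b2,
    theta = HiddenLayer W b (OutputLayer W2 b2).
Proof.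
refine (match theta as t in network _ k' l return
  match l as l' return network R k' l' -> Prop with
  | 2%N => fun t => exists (k2 : nat) (W : 'M[R]_(k2, k')) b W2 b2,
     t = HiddenLayer W b (OutputLayer W2 b2)
  | _ => fun _ => True
  end t with
  | OutputLayer k' W b => I
  | HiddenLayer k' k'' l W b t => _
  end).
case: l t => // -[|l] // t; have [W2 [b2 ->]] := network1P t.
by exists k'', W, b, W2, b2.
Qed.

Lemma realization2E k (W : 'M[R]_(k, d)) (b : 'cV[R]_k) (W2 : 'M[R]_(1, k)) (b2 : 'cV[R]_1) :
  realization (HiddenLayer W b (OutputLayer W2 b2)) =
  shallow [seq (W2 ord0 i, row i W, b i ord0) | i <- enum 'I_k] (b2 ord0 ord0).
Proof.
apply/funext => x; rewrite /shallow big_map big_enum /= !mxE; congr (_ + _).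
apply: eq_bigr => i _; rewrite /relu /ridge !mxE /=; congr (_ * Num.max 0 (_ + _)).
by rewrite /dot mxE; apply: eq_bigr => j _; rewrite mxE.
Qed.

(** The inequality [|c| r <= (c^2 + r^2) / 2] for each neuron, the factor 1/2 being the
    normalization of the cost at depth 2. *)
Lemma path_norm_cost k (W : 'M[R]_(k, d)) (b : 'cV[R]_k) (W2 : 'M[R]_(1, k)) (b2 : 'cV[R]_1) :
  path_norm [seq (W2 ord0 i, row i W, b i ord0) | i <- enum 'I_k] <=
  param_cost (HiddenLayer W b (OutputLayer W2 b2)).
Proof.
rewrite /path_norm big_map big_enum /= /param_cost /= /frobenius2 big_ord1 -big_split.
rewrite mulr_sumr ler_sum // => i _ /=.
set r := norm2 _.
have -> : \sum_j W i j ^+ 2 = r ^+ 2.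
  by rewrite norm2_sqr; apply: eq_bigr => j _; rewrite !mxE.
rewrite -[W2 ord0 i ^+ 2]real_normK ?num_real //.
by have := sqr_ge0 (`|W2 ord0 i| - r); rewrite sqrrB; nra.
Qed.

Lemma tested_by_network (theta : network R d 2) :
  tested_by (param_cost theta) (realization theta).
Proof.
have [k [W [b [W2 [b2 ->]]]]] := network2P theta.
by rewrite realization2E; apply: tested_by_le (tested_by_shallow _ _); exact: path_norm_cost.
Qed.

Lemma shallow_realizable s c0 : realizable 2 (@shallow R d s c0).
Proof.
pose D : R * 'rV[R]_d * R := (0, 0, 0).
exists (HiddenLayer (\matrix_(i < size s, j < d) (nth D s i).1.2 ord0 j)
  (\col_(i < size s) (nth D s i).2)
  (OutputLayer (\row_(i < size s) (nth D s i).1.1) (const_mx c0))).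
rewrite realization2E; apply/funext => x; rewrite /shallow big_map big_enum /= !mxE.
rewrite (big_nth D) big_mkord; congr (_ + _); apply: eq_bigr => i _.
rewrite !mxE /ridge; congr (_ * Num.max 0 (_ + _)); congr (dot _ _).
by apply/rowP => j; rewrite !mxE.
Qed.

Lemma realizable_shallow f : realizable 2 f -> exists s c0, f = @shallow R d s c0.
Proof.
move=> [theta <-]; have [k [W [b [W2 [b2 ->]]]]] := network2P theta.
by rewrite realization2E; eexists; eexists.
Qed.

Lemma frobenius2_col_mx m1 m2 n (A : 'M[R]_(m1, n)) (B : 'M[R]_(m2, n)) :
  frobenius2 (col_mx A B) = frobenius2 A + frobenius2 B.
Proof.
rewrite /frobenius2 big_split_ord /=; congr (_ + _);
  by apply: eq_bigr => i _; apply: eq_bigr => j _; rewrite ?col_mxEu ?col_mxEd.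
Qed.

Lemma frobenius2_row_mx m n1 n2 (A : 'M[R]_(m, n1)) (B : 'M[R]_(m, n2)) :
  frobenius2 (row_mx A B) = frobenius2 A + frobenius2 B.
Proof.
rewrite /frobenius2 -big_split; apply: eq_bigr => i _ /=.
rewrite big_split_ord /=; congr (_ + _);
  by apply: eq_bigr => j _; rewrite ?row_mxEl ?row_mxEr.
Qed.

Lemma frobenius2N m n (A : 'M[R]_(m, n)) : frobenius2 (- A) = frobenius2 A.
Proof. by apply: eq_bigr => i _; apply: eq_bigr => j _; rewrite mxE sqrrN. Qed.

Lemma relu_col_mx m n (u : 'cV[R]_m) (v : 'cV[R]_n) :
  relu (col_mx u v) = col_mx (relu u) (relu v).
Proof. exact: map_col_mx. Qed.

(* One more layer computes [f = relu f - relu (- f)]. *)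
Lemma deepen (theta : network R d 2) : exists theta' : network R d 3,
  realization theta' = realization theta /\
  param_cost theta' <= 2 * (param_cost theta + 1).
Proof.
have [k [W [b [W2 [b2 ->]]]]] := network2P theta.
exists (HiddenLayer W b (HiddenLayer (col_mx W2 (- W2)) (col_mx b2 (- b2))
  (OutputLayer (row_mx 1%:M (- 1%:M)) 0))); split.
  apply/funext => x /=; set r := relu (W *m x + b).
  rewrite mul_col_mx add_col_mx relu_col_mx mul_row_col mul1mx mulNmx mul1mx addr0.
  rewrite mulNmx -opprD; set u := W2 *m r + b2.
  by rewrite /relu !mxE /Num.max; do 2 case: ltP => ?; lra.
(* The new cost is [(|W|^2 + 2 |W2|^2 + 2) / 3], to be bounded by [|W|^2 + |W2|^2 + 2]. *)
rewrite /param_cost /= frobenius2_col_mx frobenius2_row_mx !frobenius2N.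
have -> : frobenius2 (1%:M : 'M[R]_1) = 1 by rewrite /frobenius2 !big_ord1 mxE expr1n.
have F m n (B : 'M[R]_(m, n)) : 0 <= frobenius2 B.
  by apply: sumr_ge0 => i _; apply: sumr_ge0 => j _; rewrite sqr_ge0.
by have := F _ _ W; have := F _ _ W2; lra.
Qed.

Lemma native2_sub3 (e : 'cV[R]_d) : native e 2 `<=` native e 3.
Proof.
apply: (@native_le R d e 2 3 2) => // f.
rewrite -lee_pdivrMl // -leeBlDr //; apply: le_ereal_inf_tmp => _ [theta thetaf <-].
rewrite leeBlDr // lee_pdivrMl //.
have [theta' [E le']] := deepen theta.
apply: (@le_trans _ _ (param_cost theta')%:E); last by rewrite -EFinD -EFinM lee_fin.
by apply: ereal_inf_lbound; exists theta' => //=; rewrite E.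
Qed.

End Networks.

(** * Shallow networks are piecewise linear *)

Section ShallowCPWL.
Variables (R : realType) (d : nat).
Implicit Types (x y : 'cV[R]_d).

Lemma coord_le_mx_norm x i : `|x i ord0| <= `|x|.
Proof.
rewrite [leRHS]/Num.norm /= mx_normrE.
exact: (le_bigmax _ (fun ij => `|x ij.1 ij.2|) (i, ord0)).
Qed.

(** Links the Euclidean Lipschitz condition to the topology, which comes from the sup norm. *)
Lemma norm2_le_mx_norm x : norm2 x <= Num.sqrt d%:R * `|x|.
Proof.
have -> : Num.sqrt d%:R * `|x| = Num.sqrt (d%:R * `|x| ^+ 2).
  by rewrite sqrtrM ?ler0n // sqrtr_sqr normr_id.
apply: ler_wsqrtr; rewrite -[d in d%:R]card_ord -sum1_card natr_sum mulr_suml.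
apply: ler_sum => i _; rewrite mul1r -[leLHS]real_normK ?num_real //.
by rewrite lerXn2r ?nnegrE // coord_le_mx_norm.
Qed.

Lemma lipschitz2_continuous (f : 'cV[R]_d -> R) : lipschitz2 f -> continuous f.
Proof.
move=> [k hk] x; apply/(@cvgrPdist_le _ _ _ (nbhs x) (nbhs_filter x)) => eps eps0.
set K := `|k| * Num.sqrt d%:R + 1.
have K0 : 0 < K by rewrite ltr_wpDl // mulr_ge0 // sqrtr_ge0.
near=> y; apply: le_trans (hk _ _) _.
apply: (@le_trans _ _ (K * `|x - y|)).
  apply: le_trans (ler_wpM2r (norm2_ge0 _) (ler_norm k)) _.
  apply: le_trans (ler_wpM2l (normr_ge0 k) (norm2_le_mx_norm _)) _.
  by rewrite mulrA ler_wpM2r // /K lerDl.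
rewrite -ler_pdivlMl //; near: y.
by apply: cvgr_dist_le; [exact: cvg_id|rewrite mulr_gt0 ?invr_gt0].
Unshelve. all: by end_near. Qed.

Lemma realizable_CPWL f : realizable 2 f -> @CPWL R d f.
Proof.
move=> rf; split.
  by have [s [c0 ->]] := realizable_shallow rf; apply/lipschitz2_continuous/shallow_lipschitz.
move: rf => [theta <-]; have [k [W [b [W2 [b2 ->]]]]] := network2P theta.
(* One closed piece per activation pattern of the hidden neurons; on it, relu acts as the mask of
   active neurons. *)
pose pat (i : 'I_#|{ffun 'I_k -> bool}|) : {ffun 'I_k -> bool} := enum_val i.
exists #|{ffun 'I_k -> bool}|, (fun i => [set x | forall j : 'I_k,
  if pat i j then 0 <= (W *m x + b) j ord0 else (W *m x + b) j ord0 <= 0]); split.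
- apply/seteqP; split => // x _.
  exists (enum_rank [ffun j => 0 <= (W *m x + b) j ord0]) => //= j.
  rewrite /pat enum_rankK ffunE; case: ifPn => //.
  by rewrite -ltNge => /ltW.
- move=> i; pose A : 'M[R]_(k, d) := \matrix_(j, l) (if pat i j then - W j l else W j l).
  exists k, A, (\col_j (if pat i j then b j ord0 else - b j ord0)).
  have AE j x : (A *m x) j ord0 = if pat i j then - (W *m x) j ord0 else (W *m x) j ord0.
    rewrite !mxE; case: ifP => pij; rewrite -?sumrN; apply: eq_bigr => l _;
      by rewrite mxE pij ?mulNr.
  by apply/seteqP; split => x /= H j; have := H j; rewrite AE [(_ + b) _ _]mxE [(\col__ _) _ _]mxE;
    case: ifP => _; lra.
- move=> i; pose M : 'M[R]_(1, k) := \row_j (if pat i j then W2 ord0 j else 0).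
  exists (M *m W), ((M *m b + b2) ord0 ord0) => x /= H.
  rewrite -mulmxA [(M *m b + b2) _ _]mxE addrA [LHS]mxE; congr (_ + _).
  have -> : (M *m (W *m x)) ord0 ord0 + (M *m b) ord0 ord0 =
    (M *m (W *m x + b)) ord0 ord0 by rewrite mulmxDr [RHS]mxE.
  rewrite [LHS]mxE [RHS]mxE; apply: eq_bigr => j _.
  rewrite [relu _ _ _]mxE [M _ _]mxE; have := H j; case: ifP => _ Hj.
    by rewrite max_r.
  by rewrite max_l // mul0r mulr0.
Qed.

End ShallowCPWL.

(** * A depth-3 network outside the depth-2 native space *)

Section Strict.
Variables (R : realType) (d : nat) (i0 i1 : 'I_d).
Hypothesis i01 : i0 != i1.

Definition wedge (x : 'cV[R]_d) : R :=
  Num.max 0 (Num.max 0 (x i1 ord0) - Num.max 0 (x i0 ord0)).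

Lemma wedge_realizable : realizable 3 wedge.
Proof.
exists (HiddenLayer (col_mx (delta_mx ord0 i1) (delta_mx ord0 i0)) 0
  (HiddenLayer (row_mx 1%:M (- 1%:M)) 0 (OutputLayer 1%:M 0))).
apply/funext => x /=; rewrite !addr0 mul1mx mul_col_mx -!rowE relu_col_mx mul_row_col.
by rewrite mulNmx !mul1mx !mxE.
Qed.

Lemma wedge_lipschitz : lipschitz2 wedge.
Proof.
exists 2 => x y; apply: le_trans (relu_lipschitz _ _) _.
have D i : `|Num.max 0 (x i ord0) - Num.max 0 (y i ord0)| <= norm2 (x - y).
  apply: le_trans (relu_lipschitz _ _) _.
  by have := coord_le_norm2 (x - y) i; rewrite !mxE.
rewrite [X in `|X|](_ : _ = (Num.max 0 (x i1 ord0) - Num.max 0 (y i1 ord0)) -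
  (Num.max 0 (x i0 ord0) - Num.max 0 (y i0 ord0))); last by ring.
by apply: le_trans (ler_normB _ _) _; have := D i0; have := D i1; lra.
Qed.

Lemma wedge_not_native2 e : ~ native e 2 wedge.
Proof.
move=> /(native_tested (@tested_by_network R d)) [C HC].
pose u (i : 'I_d) : 'cV[R]_d := delta_mx i ord0.
have wedgeE (r s : R) : wedge (r *: u i1 + s *: u i0) = Num.max 0 (Num.max 0 r - Num.max 0 s).
  rewrite /wedge !mxE !eqxx [i1 == i0]eq_sym (negbTE i01) /=.
  by rewrite !mulr0 !mulr1 addr0 add0r.
suff : -1 = 0 :> R by lra.
(* The base points lie near [u i1], where crossing [x_0 = 0] changes the slope by -1, and near
   [- u i1], where [wedge] vanishes. With [s, t < 1/4], [1 - 2 * s > t] keeps the outer maximum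
   active in the first case. *)
apply: (@jump_constant R d C wedge (u i0) (u i1) (- 2 *: u i1) 4^-1) => //.
- move=> s t /andP[s0 s1] /andP[t0 t1].
  have E (r : R) : u i1 + s *: (- 2 *: u i1) + r *: u i0 = (1 - 2 * s) *: u i1 + r *: u i0.
    have -> : 1 - 2 * s = 1 + s * - 2 by ring.
    by rewrite scalerDl scale1r scalerA.
  rewrite /second_difference -scaleNr -{3}[u i1 + _]addr0 -(scale0r (u i0)) !E !wedgeE.
  have m1 : Num.max 0 (1 - 2 * s) = 1 - 2 * s by rewrite max_r; lra.
  have m2 : Num.max 0 t = t by rewrite max_r; lra.
  have m3 : Num.max 0 (- t) = 0 by rewrite max_l; lra.
  by rewrite m1 m2 m3 maxxx /Num.max; do ! case: ltP => ?; lra.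
- move=> s t /andP[s0 s1] /andP[t0 t1].
  have E (r : R) : u i1 + - 2 *: u i1 + s *: (- 2 *: u i1) + r *: u i0 =
      (- 1 - 2 * s) *: u i1 + r *: u i0.
    have -> : - 1 - 2 * s = 1 + - 2 + s * - 2 by ring.
    by rewrite !scalerDl scale1r scalerA.
  rewrite /second_difference -scaleNr -{3}[u i1 + _ + _]addr0 -(scale0r (u i0)) !E !wedgeE.
  have m1 : Num.max 0 (- 1 - 2 * s) = 0 by rewrite max_l; lra.
  have m2 : Num.max 0 t = t by rewrite max_r; lra.
  have m3 : Num.max 0 (- t) = 0 by rewrite max_l; lra.
  by rewrite m1 m2 m3 maxxx /Num.max; do ! case: ltP => ?; lra.
Qed.

End Strict.

(** * Piecewise linear functions in the depth-2 native space *)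

Section CPWLShallow.
Variables (R : realType) (d : nat).
Implicit Types (x y : 'cV[R]_d).

(** Off the bounding hyperplanes, membership depends only on signs. Zero rows define no hyperplane,
    but their inequality holds everywhere or nowhere. *)
Lemma polyhedron_union_of_cells (P : set 'cV[R]_d) : polyhedron P ->
  exists A : seq ('rV[R]_d * R), (forall p, p \in A -> p.1 != 0) /\
    forall x y, same_side A x y -> P x -> P y.
Proof.
move=> [m [M [b ->]]].
exists [seq (row i M, b i ord0) | i <- enum 'I_m & row i M != 0]; split.
  by move=> _ /mapP[i + ->]; rewrite mem_filter => /andP[].
move=> x y xy /= Px i; have := Px i.
have ME z : (M *m z) i ord0 = dot (row i M) z by rewrite /dot -row_mul [RHS]mxE.
rewrite !ME; have [M0|M0] := eqVneq (row i M) 0.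
  by rewrite M0 /dot !mul0mx !mxE.
have /xy /= : (row i M, b i ord0) \in
    [seq (row i M, b i ord0) | i <- enum 'I_m & row i M != 0].
  by apply/map_f; rewrite mem_filter M0 mem_enum.
move=> + xb; have : dot (row i M) x - b i ord0 <= 0 by lra.
by rewrite le_eqVlt => /predU1P[->|x0]; rewrite ?mul0r ?ltxx // nmulr_rgt0 //; lra.
Qed.

(** In the arrangement of all hyperplanes bounding the pieces, an open cell lies inside every piece
    that it meets, so [f] is affine on it. *)
Lemma CPWL_shallow f C : @CPWL R d f -> lipschitz2 f -> tested_by C f ->
  exists s c0, f = shallow s c0.
Proof.
move=> [_ [n [P [PT Ppoly Paff]]]] fL fC.
have [A HA] := choice (fun i => polyhedron_union_of_cells (Ppoly i)).
apply: (@arrangement_shallow R d (flatten [seq A i | i <- enum 'I_n]) f C) => //.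
  by move=> p /flatten_mapP[i _]; apply: (HA i).1.
move=> x xx; have [i _ Pix] : (\bigcup_i P i) x by rewrite PT.
have [w [c H]] := Paff i; exists w, c => y xy; apply: H; apply: (HA i).2 Pix => p pA.
by apply: xy; apply/flatten_mapP; exists i => //; rewrite mem_enum.
Qed.

End CPWLShallow.

Theorem proposition9p10 (R : realType) (d : nat) (hd : (2 <= d)%N)
    (e : 'cV[R]_d) :
  native e 2 `<` native e 3 /\
  @CPWL R d `&` native e 2 = @realizable R d 2.
Proof.
split.
  split; first exact: native2_sub3.
  pose i0 := Ordinal (ltnW hd); pose i1 := Ordinal hd.
  have i01 : i0 != i1 by [].
  move=> /(_ (wedge i0 i1)) H; apply: (wedge_not_native2 i01 (e := e)); apply: H.
  apply: native_realizable; last exact: wedge_realizable.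
  by rewrite inE; exact: wedge_lipschitz.
apply/seteqP; split => [f [fP f2]|f fr].
  have [C fC] := native_tested (@tested_by_network R d) f2.
  have [s [c0 ->]] := CPWL_shallow fP (native_lipschitz f2) fC.
  exact: shallow_realizable.
split; first exact: realizable_CPWL.
apply: native_realizable => //; have [s [c0 ->]] := realizable_shallow fr.
by rewrite inE; exact: shallow_lipschitz.
Qed.
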